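(* Let $G$ be a torsion-free group with identity $e$ and let $R=\bigoplus_{g\in G}R_g$ be a $G$-graded associative ring with identity, of finite support. Assume that $R$ is a semiprimary ring and that $R_e$ is local and nil-good. Then $R$ is graded nil-good.
   Context: A ring $R$ is $G$-graded if $R=\bigoplus_{g\in G}R_g$ with $R_g$ additive subgroups and $R_gR_h\subseteq R_{gh}$ for all $g,h\in G$; elements of $\bigcup_{g}R_g$ are called homogeneous. The support of $R$ is $\{g\in G: R_g\neq 0\}$. A ring $R$ is semiprimary if its Jacobson radical $J(R)$ is nilpotent and $R/J(R)$ is semisimple Artinian. A ring is nil-good if each of its elements is either nilpotent or a sum of a unit and a nilpotent. A $G$-graded ring is graded nil-good if each of its homogeneous elements is either nilpotent or a sum of a homogeneous unit and a homogeneous nilpotent. *)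

(* Defs.v *)
From HB Require Import structures.
From mathcomp Require Import all_boot all_order all_algebra.
From mathcomp Require Import generic_quotient ring_quotient.
From mathcomp Require Import boolp classical_sets cardinality.

Set Implicit Arguments.
Unset Strict Implicit.
Unset Printing Implicit Defensive.

Import GRing.Theory.
Local Open Scope ring_scope.
Local Open Scope quotient_scope.

(* Rings are [pzRingType]s: associative, with 1, not necessarily commutative   *)
(* and possibly trivial.  [GRing.unit] is not available at this generality     *)
(* (it belongs to [unitRingType]), hence the predicate [is_unit].              *)

Section Elements.
Variable R : pzRingType.

Definition is_unit (u : R) : Prop := exists v : R, v * u = 1 /\ u * v = 1.

Definition is_nilpotent (x : R) : Prop := exists n : nat, x ^+ n = 0.

Definition nil_good : Prop :=
  forall x : R, is_nilpotent x \/
    exists u n : R, [/\ is_unit u, is_nilpotent n & x = u + n].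

End Elements.

(* Left ideals are the submodules of the left regular module [R^o].            *)
Notation left_ideal R := (submodClosed R^o).

Section LeftIdeals.
Variable R : pzRingType.
Implicit Types I M N : left_ideal R.

Definition maximal_left_ideal M : Prop :=
  1 \notin M /\ forall N, {subset M <= N} -> 1 \notin N -> N =i M.

Definition minimal_left_ideal M : Prop :=
  (exists2 x, x \in M & x != 0) /\
  forall N, {subset N <= M} -> (exists2 x, x \in N & x != 0) -> N =i M.

Definition local_ring : Prop :=
  exists2 M, maximal_left_ideal M & forall N, maximal_left_ideal N -> N =i M.

Definition left_artinian : Prop :=
  forall I : nat -> left_ideal R,
    (forall k, {subset I k.+1 <= I k}) ->
    exists n, forall k, (n <= k)%N -> I k =i I n.

(* The regular module is a direct sum of simple submodules; the family is     *)
(* finite, as for every direct sum decomposition of a module generated by 1.  *)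
Definition semisimple : Prop :=
  exists (n : nat) (L : 'I_n -> left_ideal R),
  [/\ forall i, minimal_left_ideal (L i),
      forall x : R, exists2 f : 'I_n -> R,
        forall i, f i \in L i & x = \sum_i f i
    & forall f : 'I_n -> R, (forall i, f i \in L i) ->
        \sum_i f i = 0 -> forall i, f i = 0].

Definition jacobson : {pred R} :=
  [pred x : R | `[< forall M, maximal_left_ideal M -> x \in M >]].

Lemma jacobsonP (x : R) :
  reflect (forall M, maximal_left_ideal M -> x \in M) (x \in jacobson).
Proof. exact: asboolP. Qed.

Lemma left_idealM I (a x : R) : x \in I -> a * x \in I.
Proof. by move=> xI; exact: (@rpredZ R R^o I a x xI). Qed.

Lemma jacobson_zmod_closed : zmod_closed jacobson.
Proof.
split; first by apply/jacobsonP => M _; exact: rpred0.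
move=> x y /jacobsonP xJ /jacobsonP yJ; apply/jacobsonP => M maxM.
rewrite -mulN1r; apply: rpredD; first exact: xJ.
by apply: left_idealM; exact: yJ.
Qed.

HB.instance Definition _ :=
  GRing.isZmodClosed.Build R jacobson jacobson_zmod_closed.

Lemma jacobsonMl (a x : R) : x \in jacobson -> a * x \in jacobson.
Proof.
by move=> /jacobsonP xJ; apply/jacobsonP => M /xJ; exact: left_idealM.
Qed.

Section Colon.
Variables (I : left_ideal R) (a : R).

Definition colon : {pred R^o} := [pred x : R^o | ((x : R) * a) \in I].

Lemma colon_submod_closed : submod_closed colon.
Proof.
split; first by rewrite inE mul0r; exact: rpred0.
move=> b u v; rewrite !inE => uI vI.
rewrite mulrDl; apply: rpredD => //.
by rewrite -[b *: u]/((b : R) * (u : R)) -mulrA; exact: left_idealM.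
Qed.

HB.instance Definition _ :=
  GRing.isSubmodClosed.Build R R^o colon colon_submod_closed.

End Colon.

Section Extend.
Variables (I : left_ideal R) (N : left_ideal R) (a : R).

Definition extend : {pred R^o} :=
  [pred y : R^o | `[< exists2 n, n \in N & (y : R) - n * a \in I >]].

Lemma extendP (y : R) :
  reflect (exists2 n : R, n \in N & y - n * a \in I) (y \in extend).
Proof. exact: asboolP. Qed.

Lemma extend_submod_closed : submod_closed extend.
Proof.
split.
  apply/extendP; exists 0; first exact: rpred0.
  by rewrite mul0r subr0; exact: rpred0.
move=> b u v /extendP[m mN umI] /extendP[n nN vnI].
apply/extendP; exists (b * m + n).
  by apply: (rpredD _ nN); exact: left_idealM.
have -> : (b *: u + v : R^o) - (b * m + n) * a
    = b * ((u : R) - m * a) + ((v : R) - n * a).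
  by rewrite mulrDl mulrBr opprD addrACA mulrA.
by apply: (rpredD _ vnI); exact: left_idealM.
Qed.

HB.instance Definition _ :=
  GRing.isSubmodClosed.Build R R^o extend extend_submod_closed.

End Extend.

Lemma colon_maximal M (a : R) :
  maximal_left_ideal M -> a \notin M ->
  maximal_left_ideal (colon M a : left_ideal R).
Proof.
move=> [M1 maxM] aM; split; first by rewrite inE mul1r.
move=> N sub N1 x; apply/idP/idP; last exact: sub.
move=> xN; rewrite inE; apply/negPn/negP => xaM.
pose E : left_ideal R := extend M N a.
have ME : {subset M <= E}.
  move=> y yM; apply/extendP; exists 0; first exact: rpred0.
  by rewrite mul0r subr0.
have [E1|E1] := boolP (1 \in E); last first.
  have := maxM E ME E1 (x * a); rewrite (negPf xaM) => /negP[].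
  by apply/extendP; exists x => //; rewrite subrr; exact: rpred0.
case/extendP: E1 => n nN n1.
case/negP: N1.
have /sub anN : (1 - a * n : R^o) \in (colon M a : left_ideal R).
  rewrite inE mulrBl mul1r -mulrA -{1}[a]mulr1 -mulrBr.
  exact: left_idealM.
rewrite -[1](subrK (a * n)).
by apply: (rpredD anN); exact: left_idealM.
Qed.

Lemma jacobsonMr (x a : R) : x \in jacobson -> x * a \in jacobson.
Proof.
move=> /jacobsonP xJ; apply/jacobsonP => M maxM.
have [aM|aM] := boolP (a \in M); first exact: left_idealM.
by have := xJ _ (colon_maximal maxM aM); rewrite inE.
Qed.

End LeftIdeals.

Section JacobsonQuotient.
Variable R : pzRingType.

Definition jacobson_quot : Type := {ideal_quot (@jacobson R)}.
HB.instance Definition _ := GRing.Zmodule.on jacobson_quot.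
HB.instance Definition _ : EqQuotient R _ jacobson_quot :=
  EqQuotient.on jacobson_quot.

Definition jq_one : jacobson_quot := \pi_jacobson_quot (1 : R).
Definition jq_mul (x y : jacobson_quot) : jacobson_quot :=
  \pi_jacobson_quot (repr x * repr y : R).

Lemma jq_piP (x y : R) :
  reflect (\pi_jacobson_quot x = \pi_jacobson_quot y) (x - y \in @jacobson R).
Proof.
by rewrite (Quotient.idealrBE (@jacobson R : zmodClosed R)); exact: eqP.
Qed.

Lemma jq_pi_mul (x y : R) :
  \pi_jacobson_quot (x * y) = jq_mul (\pi x) (\pi y).
Proof.
rewrite /jq_mul; apply/jq_piP.
set x' := repr _; set y' := repr _.
have xx' : x - x' \in @jacobson R by apply/jq_piP; rewrite reprK.
have yy' : y - y' \in @jacobson R by apply/jq_piP; rewrite reprK.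
rewrite -[x * y](subrK (x * y')) -mulrBr -addrA -mulrBl.
by apply: rpredD; [exact: jacobsonMl | exact: jacobsonMr].
Qed.

Lemma jq_pi_add (x y : R) :
  \pi_jacobson_quot (x + y) = \pi_jacobson_quot x + \pi_jacobson_quot y.
Proof. exact: (Quotient.pi_add (@jacobson R : zmodClosed R)). Qed.

Lemma jq_mulA : associative jq_mul.
Proof.
move=> x y z; rewrite -[x]reprK -[y]reprK -[z]reprK.
by rewrite -!jq_pi_mul mulrA.
Qed.

Lemma jq_mul1 : left_id jq_one jq_mul.
Proof. by move=> x; rewrite -[x]reprK -jq_pi_mul mul1r. Qed.

Lemma jq_mulr1 : right_id jq_one jq_mul.
Proof. by move=> x; rewrite -[x]reprK -jq_pi_mul mulr1. Qed.

Lemma jq_mulDl : left_distributive jq_mul +%R.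
Proof.
move=> x y z; rewrite -[x]reprK -[y]reprK -[z]reprK.
by rewrite -jq_pi_add -!jq_pi_mul -jq_pi_add mulrDl.
Qed.

Lemma jq_mulDr : right_distributive jq_mul +%R.
Proof.
move=> x y z; rewrite -[x]reprK -[y]reprK -[z]reprK.
by rewrite -jq_pi_add -!jq_pi_mul -jq_pi_add mulrDr.
Qed.

HB.instance Definition _ := GRing.Zmodule_isPzRing.Build jacobson_quot
  jq_mulA jq_mul1 jq_mulr1 jq_mulDl jq_mulDr.

Definition jacobson_nilpotent : Prop :=
  exists n : nat, forall f : 'I_n -> R,
    (forall i, f i \in @jacobson R) -> \prod_i f i = 0.

Definition semiprimary : Prop :=
  [/\ jacobson_nilpotent, semisimple jacobson_quot
    & left_artinian jacobson_quot].

End JacobsonQuotient.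

Definition torsion_free (G : groupType) : Prop :=
  forall (g : G) (n : nat), (0 < n)%N -> (g ^+ n = 1)%g -> g = 1%g.

(* The last two fields say that [R] is the sum of the additive subgroups      *)
(* [component g] and that this sum is direct.                                 *)
Record grading (G : groupType) (R : pzRingType) := Grading {
  component : G -> zmodClosed R;
  component_mul : forall g h x y,
    x \in component g -> y \in component h -> x * y \in component (g * h)%g;
  component_span : forall x : R, exists (s : seq G) (f : G -> R),
    (forall g, f g \in component g) /\ x = \sum_(g <- s) f g;
  component_free : forall (s : seq G) (f : G -> R), uniq s ->
    (forall g, f g \in component g) ->
    \sum_(g <- s) f g = 0 -> forall g, g \in s -> f g = 0
}.

Section Graded.
Variables (G : groupType) (R : pzRingType) (gr : grading G R).

Definition homogeneous (x : R) : Prop := exists g : G, x \in component gr g.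

Definition graded_support : set G :=
  [set g | exists2 x, x \in component gr g & x != 0]%classic.

Definition graded_nil_good : Prop :=
  forall x : R, homogeneous x -> is_nilpotent x \/
    exists u n : R,
      [/\ homogeneous u /\ is_unit u, homogeneous n /\ is_nilpotent n
        & x = u + n].

Definition component1 : {pred R} := component gr 1%g.

Lemma component1_1 : 1 \in component1.
Proof.
have [s0 [f0 [f0P E0]]] := component_span gr 1.
have [s [f [us s1 fP E]]] : exists s f,
    [/\ uniq s, 1%g \in s, forall g, f g \in component gr g
      & 1 = \sum_(g <- s) f g].
  pose f g := f0 g *+ count_mem g s0.
  exists (undup (1%g :: s0)), f; split.
  - exact: undup_uniq.
  - by rewrite mem_undup mem_head.
  - by move=> g; rewrite rpredMn.
  rewrite E0 /=; case: ifPn => [_|Ns].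
    rewrite -big_undup_iterop_count; apply: eq_bigr => g _.
    by rewrite /f Monoid.iteropE iter_addr_0.
  rewrite big_cons {1}/f (count_memPn Ns) mulr0n add0r.
  rewrite -big_undup_iterop_count; apply: eq_bigr => g _.
  by rewrite /f Monoid.iteropE iter_addr_0.
suff absorb h x : x \in component gr h -> x = x * f 1%g.
  have f1 : 1 = f 1%g.
    rewrite -[f _]mul1r {2}E mulr_suml {1}E.
    by apply: eq_bigr => h _; exact: absorb (fP h).
  by rewrite f1; exact: fP.
move=> xh; apply/eqP; rewrite -subr_eq0 -opprB oppr_eq0; apply/eqP.
pose F k := x * f (h^-1 * k)%g - (if k == h then x else 0).
have FP k : F k \in component gr k.
  rewrite /F rpredB //; last by case: eqP => [->|_] //; exact: rpred0.
  by have := component_mul xh (fP (h^-1 * k)%g); rewrite mulVKg.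
have := @component_free _ _ gr [seq (h * g)%g | g <- s] F.
rewrite map_inj_uniq ?us; last exact: mulgI.
have sh : h \in [seq (h * g)%g | g <- s].
  by apply/mapP; exists 1%g => //; rewrite mulg1.
move=> /(_ isT FP) free; have := free _ h sh.
rewrite /F mulVg eqxx; apply.
rewrite big_map sumrB.
under eq_bigr do rewrite mulKg.
rewrite -mulr_sumr -E mulr1 (bigD1_seq 1%g) //= mulg1 eqxx.
rewrite big1 ?addr0 ?subrr // => g g1.
by rewrite -[X in _ == X]mulg1 (inj_eq (@mulgI _ h)) (negPf g1).
Qed.

Lemma component1_subring_closed : subring_closed component1.
Proof.
split; first exact: component1_1.
- by move=> x y; exact: rpredB.
- by move=> x y x1 y1; have := component_mul x1 y1; rewrite mulg1.
Qed.

(* The ring [R_e].                                                            *)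
Definition identity_component : Type := {x : R | x \in component1}.
HB.instance Definition _ := SubChoice.on identity_component.
HB.instance Definition _ :=
  GRing.SubChoice_isSubPzRing.Build R component1 identity_component
    component1_subring_closed.

End Graded.

(* Main.v *)
Require Import Defs.
From mathcomp Require Import all_boot all_order all_algebra.
From mathcomp Require Import boolp classical_sets cardinality.

(** A homogeneous element [x] of degree [g <> 1] is nilpotent: the powers of
    [g] are pairwise distinct because [G] is torsion-free, so [x ^+ n], of
    degree [(g ^+ n)%g], falls outside the finite support for some [n] and
    vanishes there ([nilpotent_of_degree_neq1]).  A homogeneous element of
    degree [1] is an element of the ring [R_e], and its decomposition there
    is one in [R], since the inclusion of [R_e] preserves the identity,
    products and sums ([val_is_unit], [val_is_nilpotent]). *)

Import GRing.Theory.
Local Open Scope classical_set_scope.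
Local Open Scope ring_scope.

Lemma torsion_free_expg_inj (G : groupType) (g : G) :
  torsion_free G -> g <> 1%g -> injective (fun n : nat => (g ^+ n)%g).
Proof.
move=> tfG g1 m n /=.
wlog mn : m n / (m <= n)%N.
  move=> H eq_mn; have [mn|/ltnW nm] := leqP m n; first exact: H.
  by apply/esym; exact: H.
rewrite -(subnKC mn) expgnDr -[LHS]mulg1 => /mulgI gd.
have [->|d_gt0] := posnP (n - m); first by rewrite addn0.
by case: g1; exact: tfG d_gt0 (esym gd).
Qed.

Section Graded.
Variables (G : groupType) (R : pzRingType) (gr : grading G R).

Lemma component_exp (g : G) (x : R) (n : nat) :
  x \in component gr g -> x ^+ n \in component gr (g ^+ n)%g.
Proof.
move=> xg; elim: n => [|n IHn]; first exact: component1_1.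
by rewrite exprS expgS; exact: component_mul.
Qed.

Lemma nilpotent_of_degree_neq1 (g : G) (x : R) :
  torsion_free G -> finite_set (graded_support gr) ->
  g <> 1%g -> x \in component gr g -> is_nilpotent x.
Proof.
move=> tfG fin_supp g1 xg; apply: contrapT => nil_x.
have supp_exp n : graded_support gr (g ^+ n)%g.
  exists (x ^+ n); first exact: component_exp.
  by apply/eqP => xn0; apply: nil_x; exists n.
(* The exponents [n] with [g ^+ n] in the support are all of [nat], yet they
   inject into the support. *)
apply: infinite_nat.
have <- : (fun n : nat => (g ^+ n)%g) @^-1` graded_support gr = setT.
  by apply/seteqP; split=> // n _; exact: supp_exp.
by apply: finite_preimage fin_supp => m n _ _; exact: torsion_free_expg_inj.
Qed.

Lemma val_is_unit (u : identity_component gr) : is_unit u -> is_unit (val u).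
Proof. by case=> v [vu uv]; exists (val v); rewrite -!rmorphM vu uv rmorph1. Qed.

Lemma val_is_nilpotent (x : identity_component gr) :
  is_nilpotent x -> is_nilpotent (val x).
Proof. by case=> n xn0; exists n; rewrite -rmorphXn xn0 rmorph0. Qed.

End Graded.

Theorem theorem3p4 (G : groupType) (R : pzRingType) (gr : grading G R)
  (G_torsion_free : torsion_free G)
  (finite_support : finite_set (graded_support gr))
  (R_semiprimary : semiprimary R)
  (Re_local : local_ring (identity_component gr))
  (Re_nil_good : nil_good (identity_component gr)) :
  graded_nil_good gr.
Proof.
move=> x [g xg]; have [g1|g1] := eqVneq g 1%g; last first.
  by left; apply: nilpotent_of_degree_neq1 xg => //; exact/eqP.
rewrite g1 in xg; pose y : identity_component gr := Sub x xg.
have val_y : val y = x by exact: SubK.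
have [/val_is_nilpotent|[u [n [unit_u nil_n y_eq]]]] := Re_nil_good y.
  by rewrite val_y; left.
right; exists (val u), (val n); split.
- by split; [exists 1%g; exact: valP | exact: val_is_unit].
- by split; [exists 1%g; exact: valP | exact: val_is_nilpotent].
- by rewrite -val_y y_eq rmorphD.
Qed.
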